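(* Let $Z$ be a bounded normal operator with trivial kernel on a Hilbert space $\mathcal{H}$ such that $R:=Z^{-1}$ is unbounded, let $\xi\in\mathcal{H}$ with $\xi\notin\mathcal{D}(R)$, and let the operators $A,B,W$, $T_{\mathcal{C}}$, $R_t$ and the numbers $t_\gamma$, $s_{\gamma,\alpha}$ be as defined in the context. Suppose that $\mathcal{C}$ is a subspace of $\mathcal{K}=\mathcal{N}(A^* )\oplus\mathcal{N}(B^* )=\mathbb{C}\cdot\xi\oplus\mathbb{C}\cdot W^*\xi$ of the form $$\mathcal{C}=\mathbb{C}\cdot(\xi,\alpha W^*\xi)\quad\text{for some }\alpha\in\mathbb{C},\ \alpha\neq0.$$ Then the operator $T_{\mathcal{C}}$ is a normal operator if and only if there exists a $t\in\mathbb{R}\cup\{\infty\}$ such that $\xi$ is an eigenvector of the operator $R_t$. In this case, if $s$ denotes the eigenvalue of the eigenvector $\xi$ of $R_t$, the pair $(t,s)$ is uniquely determined by $\mathcal{C}$. More precisely, if the conditions $$(\alpha-\overline{\alpha}\,\gamma)Z\xi=(\gamma W^*-I)\xi\quad\text{and}\quad|\gamma|=1$$ are satisfied for a number $\gamma\in\mathbb{C}$, then $t=t_\gamma$ and $s=s_{\gamma,\alpha}$.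
   Context: $\mathcal{D}(T)$ and $\mathcal{N}(T)$ denote the domain and the kernel of an operator $T$; $T\lceil\mathcal{D}$ is the restriction of $T$ to $\mathcal{D}$. A densely defined operator $T$ is formally normal if $\mathcal{D}(T)\subseteq\mathcal{D}(T^* )$ and $\|Tx\|=\|T^*x\|$ for $x\in\mathcal{D}(T)$; it is normal if in addition $\mathcal{D}(T)=\mathcal{D}(T^* )$. The operator $R=Z^{-1}$ is normal with $R^*=(Z^* )^{-1}$, and $W$ is the unitary operator on $\mathcal{H}$ determined by $WR^*x=Rx$ for $x\in\mathcal{D}(R)=\mathcal{D}(R^* )$; then $Z=Z^*W^*$. Let $P$ be the orthogonal projection of $\mathcal{H}$ onto $\mathbb{C}\cdot\xi$. Put $\mathcal{D}(A)=\mathcal{D}(B):=Z(I-P)\mathcal{H}=Z^*W^*(I-P)\mathcal{H}$, $A:=R\lceil\mathcal{D}(A)$, $B:=R^*\lceil\mathcal{D}(B)$. These are densely defined closed formally normal operators with $\langle Ax,y\rangle=\langle x,By\rangle$ for $x\in\mathcal{D}(A)$, $y\in\mathcal{D}(B)$, and $\mathcal{N}(A^* )=\mathbb{C}\cdot\xi$, $\mathcal{N}(B^* )=\mathbb{C}\cdot W^*\xi$. For a linear subspace $\mathcal{C}$ of $\mathcal{K}$, $T_{\mathcal{C}}$ is the restriction of $A^*$ to $$\mathcal{D}(T_{\mathcal{C}})=\{x_0+(R^* )^{-1}v_1+u_1:\ x_0\in\mathcal{D}(B),\ (u_1,v_1)\in\mathcal{C}\}.$$ Write $R=X+\mathrm{i}Y$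 with strongly commuting self-adjoint operators $X,Y$. Define $R_t:=X-tY$ for $t\in\mathbb{R}$, and $R_\infty:=-Y$. The operator $R_\infty$ and the closure of $R_t$, $t\in\mathbb{R}$, are self-adjoint. For $\gamma\in\mathbb{C}$ with $|\gamma|=1$, $\gamma\ne1$, put $$t_\gamma:=\mathrm{i}(\gamma+1)(\gamma-1)^{-1},\qquad s_{\gamma,\alpha}:=(\alpha-\overline{\alpha}\,\gamma)(\gamma-1)^{-1},$$ which are real numbers; for $\gamma=1$ put $t_1:=\infty$ and $s_{1,\alpha}:=\mathrm{Im}\,\alpha$.
   Formalization: For fixed α the ''if'' direction is false (R>0, α=i, t=∞). Formal version: T_C is normal iff ξ is an eigenvector of some R_t with t=t_γ, s=s_{γ,α}, |γ|=1; and some α≠0 makes T_C normal iff ξ is an eigenvector of some R_t. For real t, R_t means its closure. *)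

(* Defs.v *)
From HB Require Import structures.
From mathcomp Require Import all_boot all_order all_algebra sesquilinear.
From mathcomp Require Import all_classical all_reals all_analysis.
From mathcomp Require Import complex.

Set Implicit Arguments.
Unset Strict Implicit.
Unset Printing Implicit Defensive.

Import Order.TTheory GRing.Theory Num.Theory.
Import numFieldNormedType.Exports.

Local Open Scope classical_set_scope.
Local Open Scope ring_scope.
Local Open Scope complex_scope.

(* A Hilbert space is a complete normed module H over R[i] with an inner
   product ip, linear in its first and conjugate-linear in its second argument,
   such that ip x x = `|x| ^+ 2.  An unbounded operator is encoded by its graph,
   a subset of H * H: (x, y) \in T reads "x is in D(T) and T x = y". *)

Section Operators.
Context {R : realType} {H : completeNormedModType R[i]}.
Implicit Types (S T : set (H * H)) (x y : H).

Definition line (V : lmodType R[i]) (v : V) : set V := range (fun c => c *: v).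

Definition graph (f : H -> H) : set (H * H) := [set p | p.2 = f p.1].
Definition dom T : set H := [set x | exists y, T (x, y)].
Definition ker_op T : set H := [set x | T (x, 0)].
Definition inv_op T : set (H * H) := [set p | T (p.2, p.1)].
Definition restrict_op T (D : set H) : set (H * H) := [set p | T p /\ D p.1].
Definition scale_op (a : R[i]) T : set (H * H) :=
  [set p | exists2 y, T (p.1, y) & p.2 = a *: y].
Definition add_op S T : set (H * H) :=
  [set p | exists y z, [/\ S (p.1, y), T (p.1, z) & p.2 = y + z]].

Definition linear_op T : Prop :=
  [/\ T (0, 0), forall a p q, T p -> T q -> T (a *: p + q)
    & forall y, T (0, y) -> y = 0].

Definition bounded_op T : Prop :=
  exists M : R, forall x y, T (x, y) -> `|y| <= M%:C * `|x|.

Definition eigenvector T (s : R[i]) x : Prop := x != 0 /\ T (x, s *: x).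

Variable ip : {dot H for Num.conj}.

Definition adj T : set (H * H) :=
  [set p | forall x y, T (x, y) -> ip y p.1 = ip x p.2].

(* The adjoint of an everywhere defined operator, as a function; meaningful
   when the adjoint is everywhere defined, e.g. when f is bounded. *)
Definition adjf (f : H -> H) (y : H) : H :=
  get [set z | adj (graph f) (y, z)].

Definition formally_normal T : Prop :=
  [/\ linear_op T, closure (dom T) = setT, dom T `<=` dom (adj T)
    & forall x y z, T (x, y) -> adj T (x, z) -> `|y| = `|z|].

Definition normal_op T : Prop := formally_normal T /\ dom T = dom (adj T).

Definition self_adjoint T : Prop :=
  [/\ linear_op T, closure (dom T) = setT & adj T = T].

Definition unitary (W : H -> H) : Prop :=
  (forall x y, ip (W x) (W y) = ip x y) /\ range W = setT.

(* Linearity follows from the symmetry condition. *)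
Definition orth_projection (P : H -> H) : Prop :=
  (forall x, P (P x) = P x) /\ (forall x y, ip (P x) y = ip x (P y)).

Definition spectral_measure (E : set R -> H -> H) : Prop :=
  [/\ forall M, measurable M -> orth_projection (E M),
      forall x, E setT x = x
    & forall F : nat -> set R, (forall n, measurable (F n)) ->
        trivIset setT F ->
        forall x, series (fun n => E (F n) x) @ \oo --> E (\bigcup_n F n) x].

(* T is the integral of the identity function with respect to E; the integral
   is taken against the measures mu = <E(.) x, x>, which determine T by
   polarization. *)
Definition spectral_measure_of T (E : set R -> H -> H) : Prop :=
  spectral_measure E /\
  forall x (mu : {measure set (measurableTypeR R) -> \bar R}),
    (forall M : set R, measurable M ->
       mu M = (complex.Re (ip (E M x) x))%:E) ->
    (dom T x <-> (\int[mu]_l (l ^+ 2)%:E < +oo)%E) /\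
    forall y, T (x, y) -> ip y x = (fine (\int[mu]_l l%:E)%E)%:C.

Definition strongly_commuting S T : Prop :=
  exists E F, [/\ spectral_measure_of S E, spectral_measure_of T F
    & forall M N x, measurable M -> measurable N ->
        E M (F N x) = F N (E M x)].

End Operators.

Section Construction.
Context {R : realType} {H : completeNormedModType R[i]}.
Variable ip : {dot H for Num.conj}.
Variables (Z P : H -> H).

Definition opR : set (H * H) := inv_op (graph Z).
Definition domA : set H := [set Z (x - P x) | x in [set: H]].
Definition opA : set (H * H) := restrict_op opR domA.
Definition opB : set (H * H) := restrict_op (adj ip opR) domA.

Definition opT (C : set (H * H)) : set (H * H) :=
  restrict_op (adj ip opA)
    [set x | exists x0 w p,
       [/\ dom opB x0, C p, inv_op (adj ip opR) (p.2, w) & x = x0 + w + p.1]].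

End Construction.

Section RealLines.
Context {R : realType} {H : completeNormedModType R[i]}.
Variables X Y : set (H * H).

(* Some t stands for the real number t, None for the point at infinity. *)
Definition opRt (t : option R) : set (H * H) :=
  match t with
  | Some t => add_op X (scale_op (- t%:C) Y)
  | None => scale_op (-1) Y
  end.

(* For real t the sum X - t Y lives on the intersection of the two domains and
   is in general only essentially self-adjoint; its closure is the self-adjoint
   operator that has eigenvectors outside that intersection.  No closure is
   needed at infinity. *)
Definition sa_opRt (t : option R) : set (H * H) :=
  if t is Some _ then closure (opRt t) else opRt t.

End RealLines.

Section Scalars.
Context {R : realType}.

Definition t_gamma (g : R[i]) : option R[i] :=
  if g == 1 then None else Some ('i%C * (g + 1) * (g - 1)^-1).

Definition s_gamma (g a : R[i]) : R[i] :=
  if g == 1 then (complex.Im a)%:C else (a - a^* * g) * (g - 1)^-1.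

End Scalars.

(* Main.v *)
Require Import Defs.
From HB Require Import structures.
From mathcomp Require Import all_boot all_order all_algebra sesquilinear.
From mathcomp Require Import all_classical all_reals all_analysis.
From mathcomp Require Import complex.
From mathcomp Require Import ring lra.

Import Order.TTheory GRing.Theory Num.Theory.
Import numFieldNormedType.Exports.

Local Open Scope classical_set_scope.
Local Open Scope complex_scope.
Local Open Scope ring_scope.

(** Everything is expressed through the bounded operator Z, with eta = W^* xi.
    From W R^* x = R x one gets W Z = Z W = Z^*, hence Z^* eta = Z xi.

    Normality.  The operator T_C is the inverse of the rank one perturbation
    v |-> Z^* v + <v, eta> / (a |xi|^2) xi of Z^*, and its adjoint is the inverse
    of the adjoint perturbation of Z ([opTP], [adj_opTP]).  Their domains are
    D(A) + C (xi + a Z xi) and D(A) + C (eta + a^* Z xi).  On D(A) both operators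
    have the same norms, so T_C is normal exactly when the two extra vectors are
    proportional by a factor g of modulus 1, which is the condition
    (a - a^* g) Z xi = g eta - xi ([opT_normalP]).

    Eigenvectors.  Symmetry of X and Y identifies R_t on D(R) = Z H: it maps Z u
    to c u + c^* W^* u, where c = (1 + t i) / 2, or c = i / 2 for t = oo.  The
    closure of this operator is {(x, y) : c x + c^* W^* x = Z y}
    ([closure_comb]), by the projection theorem in H ⊕ H
    ([orth_projection_closure]) and the commutation of W with Z.  Therefore xi is
    an eigenvector of R_t with eigenvalue s if and only if
    c xi + c^* eta = s Z xi ([eigP]).

    Comparison.  For t = t_g and s = s_(g, a) this equation is a nonzero multiple
    of the normality condition ([gamma_eq]).  Conversely each t comes from some
    g on the circle, and each real s is s_(g, a) for some nonzero a
    ([gamma_surj]); the eigenvalues are real ([eig_real]).  The pair (t, s) is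
    unique because two different equations in xi and eta would put xi on the
    line of Z xi, although xi is not in the range of Z ([eig_uniq]). *)

(** * Complex scalars *)

Section ComplexScalars.
Set Implicit Arguments.
Unset Strict Implicit.
Context {R : realType}.
Implicit Types c : R[i].

Local Notation ii := ('i%C : R[i]).

Lemma iiM : ii * ii = -1.
Proof. by rewrite -expr2 sqr_i. Qed.

Lemma iiJ : ii^* = - ii.
Proof. by apply/eqP; rewrite eq_complex /= oppr0 !eqxx. Qed.

Lemma ii0 : ii != 0.
Proof. by rewrite eq_complex /= oner_eq0 andbF. Qed.

Lemma realJ (r : R) : (r%:C)^* = r%:C.
Proof. exact: conjc_real. Qed.

Lemma ge0_realC c : 0 <= c -> exists2 t : R, c = t%:C & 0 <= t.
Proof. by case: c => a b; rewrite lecE /= => /andP[/eqP -> ?]; exists a. Qed.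

Lemma norm_small_eq0 c (M : R[i]) :
  (forall e : R, 0 < e -> `|c| <= e%:C * M) -> c = 0.
Proof.
move=> h; have [t tE t0] := ge0_realC (normr_ge0 c).
have [m mE m0] : exists2 m : R, M = m%:C & 0 <= m.
  by apply: ge0_realC; have := h 1 ltr01; rewrite mul1r; apply: le_trans.
apply/eqP; rewrite -normr_eq0 tE; apply/eqP; congr (_%:C).
apply/eqP; rewrite eq_le t0 andbT leNgt; apply/negP => t_gt0.
have m1 : 0 < m + 1 by rewrite ltr_pwDr.
have := h (t / (m + 1)) (divr_gt0 t_gt0 m1).
rewrite tE mE -rmorphM /= lecR mulrAC ler_pdivlMr // ler_pM2l //.
by apply/negP; rewrite -ltNge ltrDl.
Qed.

(** The next two lemmas reduce an identity that follows from given equations to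
    a ring identity; [l] and [m] are the multipliers of the equations. *)
Lemma lincomb1 (K : pzRingType) (a b x y l : K) :
  a = b -> x - y = l * (a - b) -> x = y.
Proof. by move=> ->; rewrite subrr mulr0 => /subr0_eq. Qed.

Lemma lincomb2 (K : pzRingType) (a b c d x y l m : K) :
  a = b -> c = d -> x - y = l * (a - b) + m * (c - d) -> x = y.
Proof. by move=> -> ->; rewrite !subrr !mulr0 addr0 => /subr0_eq. Qed.

End ComplexScalars.

(** * Inner products and orthogonal projection *)

Section HilbertSpace.
Set Implicit Arguments.
Unset Strict Implicit.
Context {R : realType} {H : completeNormedModType R[i]}.
Variable ip : {dot H for Num.conj}.
Hypothesis hip : forall x : H, ip x x = `|x| ^+ 2.
Implicit Types (x y u v : H) (K : set (H * H)) (c : R[i]).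

Lemma ipC x y : ip x y = (ip y x)^*.
Proof. by rewrite [LHS]hermC expr0 mul1r. Qed.

Lemma ipDl x y u : ip (x + y) u = ip x u + ip y u.
Proof. exact: linearDl. Qed.
Lemma ipDr x y u : ip u (x + y) = ip u x + ip u y.
Proof. exact: linearDr. Qed.
Lemma ipNl x u : ip (- x) u = - ip x u.
Proof. exact: linearNl. Qed.
Lemma ipNr x u : ip u (- x) = - ip u x.
Proof. exact: linearNr. Qed.
Lemma ipZl c x u : ip (c *: x) u = c * ip x u.
Proof. exact: linearZl_LR. Qed.
Lemma ipZr c x u : ip u (c *: x) = c^* * ip u x.
Proof. exact: linearZr_LR. Qed.
Lemma ip0l u : ip 0 u = 0.
Proof. exact: linear0l. Qed.
Lemma ip0r u : ip u 0 = 0.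
Proof. exact: linear0r. Qed.
Definition ipE := (ipDl, ipDr, ipNl, ipNr, ipZl, ipZr, ip0l, ip0r).

Lemma ip_eq0 x : ip x x = 0 -> x = 0.
Proof. by move=> /eqP; rewrite hip expf_eq0 /= normr_eq0 => /eqP. Qed.

Lemma ip_inj x y : (forall u, ip u x = ip u y) -> x = y.
Proof.
move=> e; apply/eqP; rewrite -subr_eq0; apply/eqP/ip_eq0.
by rewrite [LHS]linearBr /= e subrr.
Qed.

(** Testing against all vectors on the left-hand side of the inner product
    turns an identity between linear combinations into a polynomial one,
    without introducing conjugates. *)
Lemma ip_injl x y : (forall u, ip x u = ip y u) -> x = y.
Proof. by move=> e; apply: ip_inj => u; rewrite ipC e -ipC. Qed.

Lemma norm_eqP x y : `|x| = `|y| <-> ip x x = ip y y.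
Proof.
rewrite !hip; split=> [->//|/eqP]; rewrite eqrXn2 ?normr_ge0//.
by move/eqP.
Qed.

(** Positivity of [|y|^2 x - <x, y> y], expanded. *)
Lemma ip_CauchySchwarz x y : `|ip x y| <= `|x| * `|y|.
Proof.
have [->|y0] := eqVneq y 0; first by rewrite ip0r !normr0 mulr0.
have n0 : 0 < `|y| ^+ 2 by rewrite exprn_gt0 // normr_gt0.
have := dnorm_ge0 ip (`|y| ^+ 2 *: x - ip x y *: y).
rewrite !ipE -!hip [ip y x]ipC.
set a := ip x y; set b := ip y y; set d := ip x x.
have bR : b^* = b by rewrite {1}/b -ipC.
rewrite bR.
set t := (X in 0 <= X).
have -> : t = b * (d * b - a * a^*) by rewrite /t; ring.
rewrite pmulr_rge0 ?subr_ge0; last by rewrite /b hip.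
rewrite -normCK /b /d !hip -exprMn.
by rewrite ler_pXn2r // ?nnegrE ?mulr_ge0.
Qed.

Lemma closure_normP (D : set H) x : closure D x <->
  forall e : R, 0 < e -> exists2 u, D u & `|x - u| < e%:C.
Proof.
split=> [cl e e0|h B /nbhs_ballP[e /= e0 eB]].
  have /cl[u [Du]] : nbhs x (ball x e%:C) by apply: nbhsx_ballx; rewrite ltcR.
  by rewrite -ball_normE /= => ?; exists u.
have eC : (complex.Re e)%:C = e by rewrite RRe_real // gtr0_real.
have [|u Du xu] := h (complex.Re e); first by rewrite -ltcR eC.
by exists u; split => //; apply: eB; rewrite -ball_normE /= -eC.
Qed.

Lemma closure_pairP K x y : closure K (x, y) <->
  forall e : R, 0 < e ->
    exists u v, [/\ K (u, v), `|x - u| < e%:C & `|y - v| < e%:C].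
Proof.
split=> [cl e e0|h B /nbhs_ballP[e /= e0 eB]].
  have /cl[[u v] [Kuv]] : nbhs (x, y) (ball (x, y) e%:C).
    by apply: nbhsx_ballx; rewrite ltcR.
  by case; rewrite -ball_normE /= => ? ?; exists u, v.
have eC : (complex.Re e)%:C = e by rewrite RRe_real // gtr0_real.
have [] := h (complex.Re e); first by rewrite -ltcR eC.
move=> u [v [Kuv xu yv]]; exists (u, v); split => //; apply: eB.
by rewrite eC in xu yv; split; rewrite -ball_normE.
Qed.

(** Completeness of H with real tolerances, so that the estimates of the
    projection theorem can be carried out in R. *)
Lemma cauchy_seq_cvg (w : nat -> H) :
  (forall e : R, 0 < e -> exists N, forall m n,
     (N <= m)%N -> (N <= n)%N -> `|w m - w n| < e%:C) ->
  exists l, forall e : R, 0 < e -> exists N, forall n,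
     (N <= n)%N -> `|l - w n| < e%:C.
Proof.
move=> hw; have cw : cvg (w @ \oo).
  apply/cauchy_cvgP/cauchy_ballP => e e0.
  have eC : (complex.Re e)%:C = e by rewrite RRe_real // gtr0_real.
  have [] := hw (complex.Re e); first by rewrite -ltcR eC.
  move=> N hN; exists (w @` [set n | (N <= n)%N], w @` [set n | (N <= n)%N]).
    by split; exists N => // n /= Nn; exists n.
  case=> _ _ [[m /= mN <-] [n /= nN <-]]; rewrite -ball_normE /= -eC.
  exact: hN.
exists (lim (w @ \oo)) => e e0.
have /cvg_ballP/(_ e%:C) : w @ \oo --> lim (w @ \oo) by [].
rewrite ltcR => /(_ e0) [N _ hN]; exists N => n /hN.
by rewrite -ball_normE.
Qed.

(** The inner product of the Hilbert space H ⊕ H, in which graphs live. *)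
Definition ip2 (p q : H * H) := ip p.1 q.1 + ip p.2 q.2.
Definition sqnorm (p : H * H) : R := complex.Re (ip2 p p).

Lemma sqnormE p : (sqnorm p)%:C = `|p.1| ^+ 2 + `|p.2| ^+ 2.
Proof.
by rewrite /sqnorm /ip2 !hip RRe_real // ger0_real // addr_ge0 // exprn_ge0.
Qed.

Lemma sqnorm_ge0 p : 0 <= sqnorm p.
Proof. by rewrite -lecR sqnormE addr_ge0 // exprn_ge0. Qed.

Lemma sqnorm_ip2 p : (sqnorm p)%:C = ip2 p p.
Proof. by rewrite sqnormE /ip2 !hip. Qed.

Lemma sqnorm_comp p (e : R) : 0 < e -> sqnorm p < e ^+ 2 ->
  `|p.1| < e%:C /\ `|p.2| < e%:C.
Proof.
move=> e0; rewrite -ltcR sqnormE rmorphXn /= => h.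
by split; rewrite -(@ltr_pXn2r _ 2) ?nnegrE ?ler0c ?(ltW e0) //;
  apply: le_lt_trans h; rewrite ?lerDl ?lerDr exprn_ge0.
Qed.

Lemma sqnormD c p q : (sqnorm (p + c *: q))%:C =
  (sqnorm p)%:C + (c^* * ip2 p q + (c^* * ip2 p q)^*) + `|c| ^+ 2 * (sqnorm q)%:C.
Proof.
rewrite !sqnorm_ip2 /ip2 /= !ipE [ip q.1 p.1]ipC [ip q.2 p.2]ipC.
rewrite rmorphM rmorphD /= conjCK normCK; ring.
Qed.

(** The parallelogram law, with the midpoint made explicit: it forces
    minimising sequences of a subspace to be Cauchy. *)
Lemma sqnorm_parallelogram p q :
  sqnorm (p - q) = 2 * sqnorm p + 2 * sqnorm q - 4 * sqnorm (2^-1 *: (p + q)).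
Proof.
apply: complexI; rewrite rmorphB rmorphD !rmorphM !rmorph_nat /=.
rewrite !sqnorm_ip2 /ip2 /= !ipE fmorphV rmorph_nat.
by field.
Qed.

(** The projection theorem in H ⊕ H for the closure of a subspace K.  A sequence
    in K that minimises the distance to (x, y) is Cauchy by the parallelogram
    law.  Its limit is the projection: moving the n-th term along w in K does
    not decrease the squared distance by more than 1/(n+1), which bounds the
    inner product of the n-th residual with w. *)
Lemma orth_projection_closure K x y : K (0, 0) ->
  (forall c p q, K p -> K q -> K (c *: p + q)) ->
  exists x' y', closure K (x', y') /\
    forall u v, K (u, v) -> ip (x - x') u + ip (y - y') v = 0.
Proof.
move=> K0 KD; pose p : H * H := (x, y).
pose E := [set sqnorm (p - k) | k in K].
have E0 : E !=set0 by exists (sqnorm (p - 0)), 0.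
have lE : has_lbound E by exists 0 => _ [k _ <-]; exact: sqnorm_ge0.
pose d := inf E.
have dle k : K k -> d <= sqnorm (p - k) by move=> Kk; apply: ge_inf => //; exists k.
have : forall n : nat, exists k, K k /\ sqnorm (p - k) < d + n.+1%:R^-1.
  move=> n; have [] := @inf_adherent _ E (n.+1%:R^-1) _ (conj E0 lE).
    by rewrite invr_gt0.
  by move=> _ [k Kk <-] ?; exists k.
move=> /choice[k hk].
have small (e : R) : 0 < e -> exists N, forall n, (N <= n)%N -> n.+1%:R^-1 < e.
  move=> e0; have [N _ hN] := near_infty_natSinv_lt (PosNum e0).
  by exists N => n /hN.
have kc m n : sqnorm (k m - k n) <= 2 * m.+1%:R^-1 + 2 * n.+1%:R^-1.
  have diffE (V : zmodType) (a b c : V) : b - a = (c - a) - (c - b).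
    by rewrite opprB [RHS]addrC addrA subrK.
  have midE (V : lmodType R[i]) (a b c : V) :
      2^-1 *: (c - a + (c - b)) = c - 2^-1 *: (a + b).
    rewrite addrACA -opprD -mulr2n scalerBr -(scaler_nat _ c) scalerA mulVf ?scale1r //.
  rewrite (diffE _ (k n) (k m) p) sqnorm_parallelogram midE.
  have : d <= sqnorm (p - 2^-1 *: (k n + k m)).
    apply: dle; rewrite scalerDr; apply: (KD); first exact: (hk _).1.
    by rewrite -[_ *: k m]addr0; apply: (KD) => //; exact: (hk _).1.
  have [_] := hk m; have [_] := hk n.
  move: (n.+1%:R^-1) (m.+1%:R^-1) (sqnorm (p - k n)) (sqnorm (p - k m)) (sqnorm (p - _)).
  by move=> ? ? ? ? ?; lra.
have kC (e : R) : 0 < e -> exists N, forall m n,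
     (N <= m)%N -> (N <= n)%N -> sqnorm (k m - k n) < e ^+ 2.
  move=> e0; have [] := small (e ^+ 2 / 4); first by rewrite divr_gt0 ?exprn_gt0.
  move=> N hN; exists N => m n /hN hm /hN hn; have := kc m n; move: hm hn.
  by move: (n.+1%:R^-1) (m.+1%:R^-1) (sqnorm _) => ? ? ?; lra.
have [x' hx'] : exists l, forall e : R, 0 < e -> exists N, forall n,
     (N <= n)%N -> `|l - (k n).1| < e%:C.
  apply: (@cauchy_seq_cvg (fun n => (k n).1)) => e e0; have [N hN] := kC _ e0.
  by exists N => m n Nm Nn; have [] := sqnorm_comp e0 (hN _ _ Nm Nn).
have [y' hy'] : exists l, forall e : R, 0 < e -> exists N, forall n,
     (N <= n)%N -> `|l - (k n).2| < e%:C.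
  apply: (@cauchy_seq_cvg (fun n => (k n).2)) => e e0; have [N hN] := kC _ e0.
  by exists N => m n Nm Nn; have [] := sqnorm_comp e0 (hN _ _ Nm Nn).
exists x', y'; split.
  apply/closure_pairP => e e0; have [N hN] := hx' _ e0; have [M hM] := hy' _ e0.
  exists (k (maxn N M)).1, (k (maxn N M)).2; split.
  - by rewrite -surjective_pairing; exact: (hk _).1.
  - by apply: hN; rewrite leq_maxl.
  - by apply: hM; rewrite leq_maxr.
move=> u v Kuv; pose w := (u, v).
(* The almost minimality of k n, tested along the multiple -r z w of w, where z
   is the inner product to be bounded; r keeps r * sqnorm w below 1. *)
have kw n : `|ip2 (p - k n) w| ^+ 2 <= ((sqnorm w + 1) / n.+1%:R)%:C.
  set z := ip2 _ _; pose r := (sqnorm w + 1)^-1.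
  have w0 : 0 < sqnorm w + 1 by rewrite ltr_pwDr // sqnorm_ge0.
  have r0 : 0 < r by rewrite invr_gt0.
  have : d <= sqnorm (p - k n + (- (r%:C * z)) *: w).
    rewrite scaleNr -addrA -opprD; apply: dle.
    by rewrite addrC; apply: (KD) => //; exact: (hk _).1.
  have [A AE A0] := ge0_realC (exprn_ge0 2 (normr_ge0 z)).
  rewrite -lecR sqnormD -/z normrN normrM exprMn AE.
  have -> : (- (r%:C * z))^* * z = (- (r * A))%:C.
    by rewrite rmorphN rmorphM /= realJ rmorphN rmorphM /= -AE normCK; ring.
  have -> : ((- (r * A))%:C)^* = (- (r * A))%:C by exact: realJ.
  rewrite ger0_norm ?ler0c ?(ltW r0) // -!(rmorphXn, rmorphM, rmorphD) /= !lecR.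
  have [_] := hk n; move: (sqnorm (p - _)) (n.+1%:R^-1) => q i hq hd.
  have hi : r ^+ 2 * A * sqnorm w <= r * A.
    have -> : r ^+ 2 * A * sqnorm w = r * A * (r * sqnorm w) by ring.
    rewrite ler_piMr ?mulr_ge0 ?(ltW r0) //.
    by rewrite mulrC ler_pdivrMr // mul1r lerDl.
  rewrite mulrC -ler_pdivrMr // -/r; lra.
apply: (norm_small_eq0 (M := 1 + `|u| + `|v|)) => e e0.
have i0 : 0 < e ^+ 2 / (sqnorm w + 1).
  by rewrite divr_gt0 ?exprn_gt0 // ltr_pwDr // sqnorm_ge0.
have [N1 h1] := hx' _ e0; have [N2 h2] := hy' _ e0; have [N3 h3] := small _ i0.
pose n := maxn N1 (maxn N2 N3).
have {}h1 : `|x' - (k n).1| < e%:C by apply: h1; rewrite leq_maxl.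
have {}h2 : `|y' - (k n).2| < e%:C.
  by apply: h2; rewrite !leq_max leqnn orbT.
have {}h3 : n.+1%:R^-1 < e ^+ 2 / (sqnorm w + 1).
  by apply: h3; rewrite !leq_max leqnn !orbT.
have -> : ip (x - x') u + ip (y - y') v =
    ip2 (p - k n) w - (ip (x' - (k n).1) u + ip (y' - (k n).2) v).
  rewrite /ip2 /= !ipE; ring.
apply: le_trans (ler_normB _ _) _; rewrite -addrA mulrDr mulr1 lerD //.
  rewrite -(@ler_pXn2r _ 2) ?nnegrE ?normr_ge0 ?ler0c ?(ltW e0) //.
  apply: le_trans (kw n) _; rewrite -rmorphXn /= lecR mulrC.
  by rewrite -ler_pdivlMr ?(ltW h3) // ltr_pwDr // sqnorm_ge0.
apply: le_trans (ler_normD _ _) _; rewrite mulrDr lerD //.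
  by apply: le_trans (ip_CauchySchwarz _ _) _; rewrite ler_wpM2r // ltW.
by apply: le_trans (ip_CauchySchwarz _ _) _; rewrite ler_wpM2r // ltW.
Qed.

(** Orthogonality passes to the closure.  Every closedness property of graphs
    and adjoints below is an instance. *)
Lemma closure_orth K p q : (forall u v, K (u, v) -> ip u p + ip v q = 0) ->
  forall x y, closure K (x, y) -> ip x p + ip y q = 0.
Proof.
move=> hK x y /closure_pairP cl; apply: (norm_small_eq0 (M := `|p| + `|q|)) => e e0.
have [u [v [/hK Kuv xu yv]]] := cl _ e0.
have -> : ip x p + ip y q = ip (x - u) p + ip (y - v) q + (ip u p + ip v q).
  rewrite !ipE; ring.
rewrite Kuv addr0; apply: le_trans (ler_normD _ _) _; rewrite mulrDr lerD //.
  by apply: le_trans (ip_CauchySchwarz _ _) _; rewrite ler_wpM2r // ltW.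
by apply: le_trans (ip_CauchySchwarz _ _) _; rewrite ler_wpM2r // ltW.
Qed.

(** The residual of the projection onto the closure of D is orthogonal to D.
    D is embedded in H ⊕ H as D ⊕ 0. *)
Lemma dense_orth (D : set H) : D 0 ->
  (forall c x y, D x -> D y -> D (c *: x + y)) ->
  (forall y, (forall x, D x -> ip x y = 0) -> y = 0) ->
  closure D = setT.
Proof.
move=> D0 DD Dorth; apply/seteqP; split=> // x _.
pose K : set (H * H) := [set p | D p.1 /\ p.2 = 0].
have [||x' [y' [cl orth]]] := @orth_projection_closure K x 0.
- by split.
- move=> c [p1 p2] [q1 q2] [/= Dp ->] [/= Dq ->].
  by split; [apply: DD | rewrite /= scaler0 addr0].
have -> : x = x'.
  apply/eqP; rewrite -subr_eq0; apply/eqP/Dorth => u Du.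
  have := orth u 0 (conj Du erefl); rewrite ip0r addr0 => h.
  by rewrite ipC h rmorph0.
apply/closure_normP => e /(proj1 (closure_pairP _ _ _) cl)[u [v [[/= Du _] xu _]]].
by exists u.
Qed.

(** The norms in the polarization identity determine the inner product.  Stated
    for vectors, it applies to maps that are not bundled as linear ones, such as
    an adjoint. *)
Lemma polarization x y u v : ip x x = ip u u -> ip y y = ip v v ->
  ip (x + y) (x + y) = ip (u + v) (u + v) ->
  ip (x + 'i%C *: y) (x + 'i%C *: y) = ip (u + 'i%C *: v) (u + 'i%C *: v) ->
  ip x y = ip u v.
Proof.
move=> xu yv; rewrite !ipE !xu !yv.
rewrite iiJ => h1 h2.
have {}h1 : ip x y + ip y x = ip u v + ip v u.
  by apply: (addrI (ip u u)); apply: (addIr (ip v v)); rewrite -!addrA !addrA in h1 *.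
have {h2}h2 : ip x y - ip y x = ip u v - ip v u.
  apply: (@mulfI _ (- 'i%C)).
    by rewrite oppr_eq0 ii0.
  apply: (addrI (ip u u)); apply: (addIr (ip v v)).
  have e (s t : R[i]) : ip u u + - 'i%C * (s - t) + ip v v =
    ip u u + - 'i%C * s + ('i%C * t + 'i%C * (- 'i%C * ip v v)).
    by rewrite mulrCA mulNr; ring: (iiM (R := R)).
  by rewrite !e.
apply: (@mulfI _ 2); first by rewrite pnatr_eq0.
have e (s t : R[i]) : 2 * s = (s + t) + (s - t) by ring.
by rewrite (e _ (ip y x)) h1 h2 -e.
Qed.

End HilbertSpace.

(** * The operators A and T_C in terms of the bounded inverse Z *)

(** The adjoint of Z is written Zs and the inverse (and adjoint) of W is written
    Wi.  All unbounded operators are rewritten through Z: the graph of R = Z^-1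
    consists of the pairs (Z u, u), and that of its adjoint of the pairs
    (Zs v, v). *)
Section Model.
Set Implicit Arguments.
Unset Strict Implicit.
Context {R : realType} {H : completeNormedModType R[i]}.
Variable ip : {dot H for Num.conj}.
Hypothesis hip : forall x : H, ip x x = `|x| ^+ 2.
Variables (Z W P : {linear H -> H}) (Zs Wi : H -> H) (xi : H).
Hypothesis ZsP : forall x y, ip (Z x) y = ip x (Zs y).
Hypothesis WiP : forall x y, ip (W x) y = ip x (Wi y).
Hypothesis WK : cancel W Wi.
Hypothesis WiK : cancel Wi W.
Hypothesis WZ : forall x, W (Z x) = Zs x.
Hypothesis ZW : forall x, Z (W x) = Zs x.
Hypothesis Zinj : forall x, Z x = 0 -> x = 0.
Hypothesis xiZ : forall x, Z x <> xi.
Implicit Types (x y u v : H) (c a g : R[i]).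

Let eta := Wi xi.

Lemma WiD x y : Wi (x + y) = Wi x + Wi y.
Proof. by apply: (can_inj WK); rewrite linearD !WiK. Qed.
Lemma Wi0 : Wi 0 = 0.
Proof. by apply: (can_inj WK); rewrite WiK linear0. Qed.
Lemma WiZ c x : Wi (c *: x) = c *: Wi x.
Proof. by apply: (can_inj WK); rewrite linearZ /= !WiK. Qed.
Lemma ZsD x y : Zs (x + y) = Zs x + Zs y.
Proof. by rewrite -!WZ !linearD. Qed.
Lemma ZsZ c x : Zs (c *: x) = c *: Zs x.
Proof. by rewrite -!WZ !linearZ. Qed.
Lemma WiZs x : Wi (Zs x) = Z x.
Proof. by rewrite -WZ WK. Qed.
Lemma ZsWi x : Zs (Wi x) = Z x.
Proof. by rewrite -ZW WiK. Qed.
Lemma WiZC x : Wi (Z x) = Z (Wi x).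
Proof. by apply: (can_inj WK); rewrite WiK WZ ZsWi. Qed.
Lemma Zs_inj x : Zs x = 0 -> x = 0.
Proof. by rewrite -ZW => /Zinj e; apply: (can_inj WK); rewrite e linear0. Qed.
Lemma Zs_injective x y : Zs x = Zs y -> x = y.
Proof.
move=> e; apply/eqP; rewrite -subr_eq0; apply/eqP/Zs_inj.
by rewrite -scaleN1r ZsD ZsZ e scaleN1r subrr.
Qed.
Lemma ip_Wi x y : ip (Wi x) (Wi y) = ip x y.
Proof. by rewrite -WiP WiK. Qed.
Lemma Wi_adj x y : ip (Wi x) y = ip x (W y).
Proof. by rewrite -[X in ip _ X]WK ip_Wi. Qed.
Lemma Zs_adj x y : ip (Zs x) y = ip x (Z y).
Proof. by rewrite ipC -ZsP -ipC. Qed.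
Lemma norm_Wi x : `|Wi x| = `|x|.
Proof. by apply/(norm_eqP hip); rewrite ip_Wi. Qed.

(** This is how xi being outside the domain of R enters all the uniqueness
    arguments. *)
Lemma line_rangeZ c x : Z x = c *: xi -> c = 0 /\ x = 0.
Proof.
move=> e; have [c0|c0] := eqVneq c 0.
  by split=> //; apply: Zinj; rewrite e c0 scale0r.
by case: (@xiZ (c^-1 *: x)); rewrite linearZ /= e scalerA mulVf // scale1r.
Qed.

Lemma xi_neq0 : ip xi xi != 0.
Proof.
apply/eqP => /(ip_eq0 hip) e; apply: (@xiZ 0); by rewrite linear0 e.
Qed.

Lemma orth_decomp x : exists y c, ip y xi = 0 /\ x = y + c *: xi.
Proof.
exists (x - (ip x xi / ip xi xi) *: xi), (ip x xi / ip xi xi); split.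
  by rewrite !ipE divfK ?subrr // xi_neq0.
by rewrite subrK.
Qed.

Lemma orth_orth u : (forall x, ip x xi = 0 -> ip x u = 0) -> exists c, u = c *: xi.
Proof.
move=> h; have [y [c [yxi uE]]] := orth_decomp u; exists c.
have := h y yxi; rewrite {1}uE !ipE yxi mulr0 addr0 => /(ip_eq0 hip) y0.
by rewrite uE y0 add0r.
Qed.

Hypothesis Pxi : forall x, exists c, P x = c *: xi.
Hypothesis PP : forall x, P (P x) = P x.
Hypothesis Psym : forall x y, ip (P x) y = ip x (P y).
Hypothesis Pxi_fix : P xi = xi.

Lemma adj_opRP x y : adj ip (opR Z) (x, y) <-> x = Zs y.
Proof.
split=> [h|/= -> u v]; last by rewrite /opR /inv_op /graph /= => ->; rewrite -ZsP.
by apply: (ip_inj hip) => u; have /= -> := h (Z u) u erefl; rewrite ZsP.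
Qed.

Lemma domAP w : domA Z P w <-> exists2 x, ip x xi = 0 & w = Z x.
Proof.
split=> [[x _ <-]|[x xxi ->]].
  by exists (x - P x) => //; rewrite !ipE Psym Pxi_fix subrr.
exists x => //; suff -> : P x = 0 by rewrite subr0.
have [c cE] := Pxi x; apply: (ip_eq0 hip).
by rewrite Psym PP cE ipZr xxi mulr0.
Qed.

Lemma opAP u v : opA Z P (u, v) <-> u = Z v /\ ip v xi = 0.
Proof.
rewrite /opA /restrict_op /opR /inv_op /graph /=; split.
  move=> [-> /domAP[x xxi e]]; split=> //.
  suff -> : v = x by [].
  apply/eqP; rewrite -subr_eq0; apply/eqP/Zinj; by rewrite linearB /= e subrr.
by move=> [-> vxi]; split=> //; apply/domAP; exists v.
Qed.

(** D(A) consists of the Z x with x orthogonal to xi, so (u, v) lies in the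
    graph of the adjoint if and only if u - Zs v is orthogonal to xi^⊥. *)
Lemma adj_opAP u v : adj ip (opA Z P) (u, v) <-> exists c, u = Zs v + c *: xi.
Proof.
split=> [h|[c ->] x y /opAP[-> yxi]]; last first.
  by rewrite /= !ipE yxi mulr0 addr0 -ZsP.
have [|c cE] := @orth_orth (u - Zs v).
  move=> x xxi; rewrite !ipE -ZsP.
  by have /= -> := h (Z x) x (proj2 (opAP _ _) (conj erefl xxi)); rewrite subrr.
by exists c; rewrite -cE addrC subrK.
Qed.

Let TC a := opT ip Z P (line (xi, a *: eta)).
Let n2 := ip xi xi.

(** For nonzero a, T_C is the inverse of the bounded operator Zs + (a n2)^-1 <., eta> xi, a
    rank one perturbation of Zs; the vector v = Wi w is parametrised by w so
    that Zs v = Z w. *)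
Lemma opTP a u v : TC a (u, v) <-> exists w c,
  [/\ ip w xi = c * a * n2, u = Z w + c *: xi & v = Wi w].
Proof.
split.
  move=> [/adj_opAP[k uE] /= [x0 [w [p [[y0 [/= _ /domAP[x xxi x0E]]] [c _ pE]]]]]].
  rewrite -pE /inv_op /= => /adj_opRP wE uE'; exists (W v), k.
  rewrite ZW WK; split=> //.
  have [] := @line_rangeZ (c - k) (W v - x - (c * a) *: xi).
    rewrite !linearB linearZ /= ZW.
    have -> : Zs v = u - k *: xi by rewrite uE addrK.
    rewrite uE' x0E wE !ZsZ ZsWi; apply: (ip_injl hip) => t.
    by rewrite !ipE; ring.
  move/eqP; rewrite subr_eq0 => /eqP <- /eqP; rewrite -addrA -opprD subr_eq0.
  by move=> /eqP ->; rewrite !ipE xxi add0r.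
move=> [w [c [wxi -> ->]]]; split.
  by apply/adj_opAP; exists c; rewrite ZsWi.
exists (Z (w - (c * a) *: xi)), ((c * a) *: Z xi), (c *: xi, c *: (a *: eta)); split.
- exists (Wi (w - (c * a) *: xi)); split; first by apply/adj_opRP; rewrite ZsWi.
  by apply/domAP; exists (w - (c * a) *: xi) => //; rewrite !ipE wxi subrr.
- by exists c.
- by apply/adj_opRP; rewrite /= !ZsZ ZsWi scalerA.
- by rewrite /= linearB linearZ /= subrK.
Qed.

(** Correspondingly, the adjoint of T_C is the inverse of
    Z + (a^* n2)^-1 <., xi> eta. *)
Lemma adj_opTP a u v : a != 0 -> adj ip (TC a) (u, v) <-> exists k,
  ip v xi = k * a^* * n2 /\ u = Z v + k *: eta.
Proof.
move=> a0; have n2J : n2^* = n2 by rewrite -ipC.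
have etaZ y : ip eta (Z y) = ip (Z xi) y by rewrite -WiZs ip_Wi -ZsP.
split=> [h|[k [vxi ->]] x y /opTP[w [c [wxi -> ->]]]]; last first.
  rewrite /= !ipE -WiZs !ip_Wi -ZsP wxi [ip xi v]ipC vxi !rmorphM /= conjCK n2J.
  ring.
have [|k kE] := @orth_orth (W u - Zs v).
  move=> w wxi; rewrite !ipE -ZsP -Wi_adj.
  have /= -> := h (Z w) (Wi w); rewrite ?subrr //.
  by apply/opTP; exists w, 0; rewrite !mul0r scale0r addr0.
have uE : u = Z v + k *: eta.
  apply: (can_inj WK); rewrite linearD linearZ /= WZ WiK -kE addrC subrK //.
exists k; split=> //.
have := h (Z (a *: xi) + xi) (Wi (a *: xi)).
rewrite /= uE !(WiZ, linearZ) /= !ipE etaZ ip_Wi => e.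
have {}e : a * ip (Z xi) v + a * (k^* * n2) = a * ip (Z xi) v + ip xi v.
  rewrite -e; first by rewrite mulrDr.
  by apply/opTP; exists (a *: xi), 1; rewrite linearZ /= WiZ scale1r !ipE mul1r.
by rewrite ipC -(addrI _ e) !rmorphM /= conjCK n2J; ring.
Qed.

Lemma adj_opT_fun a u v v' : a != 0 ->
  adj ip (TC a) (u, v) -> adj ip (TC a) (u, v') -> v = v'.
Proof.
move=> a0 /(adj_opTP _ _ a0)[k [_ ->]] /(adj_opTP _ _ a0)[k' [_ e]].
have [] := @line_rangeZ (k' - k) (W (v - v')).
  rewrite ZW -WZ linearB /=.
  have -> : Z v - Z v' = (k' - k) *: eta.
    rewrite -[Z v](addrK (k *: eta)) e; apply: (ip_injl hip) => t.
    by rewrite !ipE; ring.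
  by rewrite linearZ /= WiK.
move=> _ e'; apply/eqP; rewrite -subr_eq0; apply/eqP/(can_inj WK).
by rewrite e' linear0.
Qed.

Lemma opT_linear a : linear_op (TC a).
Proof.
split.
- by apply/opTP; exists 0, 0; rewrite ip0l !mul0r linear0 scale0r addr0 Wi0.
- move=> c [u1 v1] [u2 v2] /opTP[w1 [c1 [h1 -> ->]]] /opTP[w2 [c2 [h2 -> ->]]].
  apply/opTP; exists (c *: w1 + w2), (c * c1 + c2); split.
  + by rewrite !ipE h1 h2; ring.
  + by rewrite linearP /=; apply: (ip_injl hip) => t; rewrite !ipE; ring.
  + by rewrite WiD WiZ.
- move=> y /opTP[w [c [_ /esym/eqP]]]; rewrite addr_eq0 -scaleNr => /eqP.
  by move=> /line_rangeZ[_ ->] ->; rewrite Wi0.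
Qed.

(** If y is orthogonal to D(A) then Zs y is a multiple of xi; as the range of Zs
    is that of Z, it must vanish. *)
Lemma opT_dense a : closure (dom (TC a)) = setT.
Proof.
have [T0 TL _] := opT_linear a.
apply: (dense_orth hip).
- by exists 0.
- by move=> c x y [u Tu] [v Tv]; exists (c *: u + v); exact: (TL c _ _ Tu Tv).
move=> y hy; have [w wxi|c cE] := @orth_orth (Zs y).
  rewrite -ZsP; apply: hy; exists (Wi w); apply/opTP; exists w, 0.
  by rewrite !mul0r scale0r addr0.
have [_ e] : c = 0 /\ W y = 0 by apply: line_rangeZ; rewrite ZW.
by apply: (can_inj WK); rewrite e linear0.
Qed.

(** The domains of T_C and its adjoint are D(A) + C (xi + a Z xi) and
    D(A) + C (eta + a^* Z xi), and on D(A) both operators have the same norms.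
    If T_C is normal, its adjoint maps xi + a Z xi to some y + k a^* xi with y
    orthogonal to xi, while T_C maps it to a eta.  The equality of norms persists
    after adding Z z for any z orthogonal to xi; comparing z = 0 with z = y gives
    y = 0, and then |k| = 1 and xi + a Z xi = k (eta + a^* Z xi).  Conversely,
    this identity makes the domains equal. *)
Lemma opT_normalP a : a != 0 -> normal_op ip (TC a) <->
  exists2 g, `|g| = 1 & (a - a^* * g) *: Z xi = g *: eta - xi.
Proof.
move=> a0; have n0 : n2 != 0 := xi_neq0.
split=> [[[_ _ Tdom Tnorm] _]|[g g1 gE]].
  have /Tdom[v] : dom (TC a) (Z (a *: xi) + xi).
    exists (Wi (a *: xi)); apply/opTP; exists (a *: xi), 1.
    by rewrite scale1r !ipE mul1r.
  move=> /(adj_opTP _ _ a0)[k [vxi uE]].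
  have norms y : ip y xi = 0 ->
      ip (y + a *: xi) (y + a *: xi) = ip (y + v) (y + v).
    move=> yxi; apply/(norm_eqP hip).
    rewrite -norm_Wi; apply: (Tnorm (Z (y + a *: xi) + xi)).
      apply/opTP; exists (y + a *: xi), 1.
      by rewrite scale1r ipDl ipZl yxi add0r mul1r.
    apply/(adj_opTP _ _ a0); exists k; split.
      by rewrite ipDl yxi add0r.
    by rewrite !linearD /= -!addrA uE.
  pose y := v - (k * a^*) *: xi.
  have yxi : ip y xi = 0 by rewrite /y !ipE vxi subrr.
  have xiy : ip xi y = 0 by rewrite ipC yxi rmorph0.
  have vE : v = y + (k * a^*) *: xi by rewrite /y subrK.
  clearbody y.
  have h0 := norms 0 (ip0l _ _); rewrite !add0r in h0.
  have hy := norms y yxi.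
  rewrite vE !ipE yxi xiy -/n2 in h0 hy.
  have y0 : y = 0.
    apply: (ip_eq0 hip); have : 2 * ip y y = 0.
      by apply: (lincomb2 (l := -1) (m := 1) hy h0); ring.
    by move/eqP; rewrite mulf_eq0 pnatr_eq0 => /eqP.
  rewrite vE y0 add0r in uE h0; exists k.
    have : (a * (a^* * n2)) * (`|k| ^+ 2 - 1) = 0.
      rewrite normCK; move: h0; rewrite !ipE rmorphM /= conjCK => h0.
      by apply: (lincomb1 (l := -1) h0); ring.
    move/eqP; rewrite !mulf_eq0 conjC_eq0 (negPf a0) (negPf n0) /= subr_eq0.
    by rewrite sqrp_eq1 // => /eqP.
  rewrite !linearZ /= in uE; apply: (ip_injl hip) => t.
  have := congr1 (ip^~ t) uE; rewrite /= !ipE => {}uE.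
  by apply: (lincomb1 (l := 1) uE); ring.
have gV : g * g^* = 1 by rewrite -normCK g1 expr1n.
have gE' : a *: Z xi + xi = (g * a^*) *: Z xi + g *: eta.
  apply: (ip_injl hip) => t; have := congr1 (ip^~ t) gE; rewrite /= !ipE => e.
  by apply: (lincomb1 (l := 1) e); ring.
(* T_C has the value Wi w here; its adjoint only multiplies the component of w
   along xi by a number of modulus 1. *)
have Tadj w c : ip w xi = c * a * n2 ->
    adj ip (TC a) (Z w + c *: xi, w - (c * a) *: xi + (c * g * a^*) *: xi).
  move=> wxi; apply/(adj_opTP _ _ a0); exists (c * g); split.
    by rewrite !ipE wxi /n2; ring.
  rewrite !linearD linearN !linearZ /=.
  apply: (ip_injl hip) => t; have := congr1 (ip^~ t) gE'; rewrite /= !ipE => e.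
  by apply: (lincomb1 (l := c) e); ring.
split; [split|].
- exact: opT_linear.
- exact: opT_dense.
- move=> u [v /opTP[w [c [wxi -> _]]]].
  by exists (w - (c * a) *: xi + (c * g * a^*) *: xi); exact: Tadj.
- move=> u v v' /opTP[w [c [wxi -> ->]]] h; rewrite norm_Wi.
  rewrite (adj_opT_fun a0 h (Tadj _ _ wxi)).
  pose x := w - (c * a) *: xi; have xxi : ip x xi = 0 by rewrite /x !ipE wxi subrr.
  have xix : ip xi x = 0 by rewrite ipC xxi rmorph0.
  rewrite -/x -[w](subrK ((c * a) *: xi)) -/x; apply/(norm_eqP hip).
  move: (x) xxi xix => {}x xxi xix.
  rewrite !ipE xxi xix !rmorphM /= conjCK.
  by apply: (lincomb1 (l := - (a * a^* * c * c^* * n2)) gV); rewrite /n2; ring.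
apply/seteqP; split => u.
  move=> [v /opTP[w [c [wxi -> _]]]].
  by exists (w - (c * a) *: xi + (c * g * a^*) *: xi); exact: Tadj.
move=> [v /(adj_opTP _ _ a0)[k [vxi ->]]].
pose c := k * g^*; pose w := v - (k * a^*) *: xi + (c * a) *: xi.
exists (Wi w); apply/opTP; exists w, c; split=> //.
  by rewrite /w !ipE vxi /n2; ring.
rewrite /w !linearD linearN !linearZ /=.
apply: (ip_injl hip) => t; have := congr1 (ip^~ t) gE'; rewrite /= !ipE => e.
rewrite /c.
by apply: (lincomb2 (l := - k * g^*)
  (m := - k * (a^* * ip (Z xi) t + ip eta t)) e gV); ring.
Qed.

(** * The self-adjoint operators R_t *)

(** On D(R), u = R x is sent by comb a to (a R + a^* R^* ) x, so the real linear
    combinations of X and Y are the operators comb a for suitable a. *)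
Definition comb a u := a *: u + a^* *: Wi u.

(** The adjoint of comb a is W comb a, just as the adjoint of Z is W Z.  Hence
    the operator Z u |-> comb a u is symmetric. *)
Lemma comb_adj a u v : ip (comb a u) v = ip u (W (comb a v)).
Proof. by rewrite linearD !linearZ /= WiK !ipE Wi_adj conjCK addrC. Qed.

Lemma Z_comb a u : Z (comb a u) = comb a (Z u).
Proof. by rewrite linearD !linearZ /= -WiZC. Qed.

Lemma comb_W a u : comb a (W u) = W (comb a u).
Proof. by rewrite linearD !linearZ /= WiK /comb WK. Qed.

Lemma combD a u v : comb a (u + v) = comb a u + comb a v.
Proof. by rewrite /comb WiD !scalerDr addrACA. Qed.

Lemma combN a u : comb a (- u) = - comb a u.
Proof.
rewrite /comb -scaleN1r WiZ !scalerA ![_ * -1]mulrC.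
by rewrite -!scalerA -scalerDr scaleN1r.
Qed.

Lemma comb_scale a c u : comb a (c *: u) = c *: comb a u.
Proof. by rewrite /comb WiZ !scalerA ![_ * c]mulrC -!scalerA scalerDr. Qed.

Definition comb_op a : set (H * H) := [set p | exists u, p = (Z u, comb a u)].

(** This replaces the spectral theorem: the symmetric operator
    Z u |-> comb a u is essentially self-adjoint.  A pair (d, f)
    with comb a d = Z f that is orthogonal to the graph also satisfies
    Zs d + (comb a)^* f = 0; testing this against Zs d gives
    |Z d|^2 + |Z f|^2 = 0. *)
Lemma closure_comb a x y : closure (comb_op a) (x, y) <-> comb a x = Z y.
Proof.
have sub x0 y0 : closure (comb_op a) (x0, y0) -> comb a x0 = Z y0.
  move=> cl; apply: (ip_injl hip) => h.
  have : ip x0 (W (comb a h)) + ip y0 (- Zs h) = 0.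
    apply: (closure_orth hip) cl => _ _ [u [-> ->]].
    by rewrite ipNr -comb_adj -ZsP Z_comb subrr.
  by rewrite ipNr -comb_adj -ZsP => /subr0_eq.
split=> [/sub //|e].
have [||x' [y' [cl orth]]] := @orth_projection_closure _ _ _ hip (comb_op a) x y.
- by exists 0; rewrite linear0 /comb Wi0 !scaler0 addr0.
- move=> c _ _ [u ->] [v ->]; exists (c *: u + v).
  by rewrite linearP combD comb_scale.
pose d := x - x'; pose f := y - y'.
have e' := sub _ _ cl.
have df : comb a d = Z f by rewrite /d /f combD combN e e' linearB.
have o u : ip d (Z u) + ip f (comb a u) = 0 by apply: orth; exists u.
have Zd : ip (Z d) (Z d) + ip (Z f) (Z f) = 0.
  rewrite -(o (Zs d)); congr (_ + _).
    by rewrite -[RHS]Zs_adj -WZ WiP WK.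
  by rewrite -ZW -Z_comb comb_W ZW -ZsP df.
have d0 : d = 0.
  apply/Zinj/(ip_eq0 hip)/eqP; rewrite eq_le dnorm_ge0 andbT.
  by rewrite -Zd lerDl dnorm_ge0.
have f0 : f = 0.
  by apply: Zinj; rewrite -df d0 /comb Wi0 !scaler0 addr0.
by move/subr0_eq: d0 => ->; move/subr0_eq: f0 => ->.
Qed.

Variables X Y : set (H * H).
Hypothesis Xsa : self_adjoint ip X.
Hypothesis Ysa : self_adjoint ip Y.
Hypothesis RXY : opR Z = add_op X (scale_op 'i%C Y).

Lemma sa_sym (T : set (H * H)) x y u v : self_adjoint ip T ->
  T (x, y) -> T (u, v) -> ip y u = ip x v.
Proof. by case=> _ _ eT Txy; rewrite -{1}eT => /(_ _ _ Txy). Qed.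

Local Notation ii := ('i%C : R[i]).

(** By symmetry of X and Y the vector y - i z is the value of R^* at x, so
    Wi (y + i z) = y - i z: the real and imaginary parts of R are recovered from
    R and R^* as expected. *)
Lemma XY_Z x y z : X (x, y) -> Y (x, z) ->
  [/\ x = Z (y + ii *: z), y = comb 2^-1 (y + ii *: z)
    & z = comb (- ii / 2) (y + ii *: z)].
Proof.
move=> Xxy Yxz.
have xE : x = Z (y + ii *: z).
  have : opR Z (x, y + ii *: z) by rewrite RXY; exists y, (ii *: z); split=> //; exists z.
  by [].
have WiE : Wi (y + ii *: z) = y - ii *: z.
  apply: Zs_injective; rewrite ZsWi -xE; apply/adj_opRP => p q.
  rewrite RXY => -[y' [_ [/= Xp [z' /= Yp ->] ->]]].
  rewrite !ipE (sa_sym Xsa Xp Xxy) (sa_sym Ysa Yp Yxz) iiJ; ring.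
split=> //; rewrite /comb WiE; apply: (ip_injl hip) => t; rewrite !ipE.
  by rewrite fmorphV rmorph_nat; field.
rewrite rmorphM rmorphN /= iiJ fmorphV rmorph_nat.
by apply: (lincomb1 (l := ip z t) iiM); field.
Qed.

Lemma XY_range u : X (Z u, comb 2^-1 u) /\ Y (Z u, comb (- ii / 2) u).
Proof.
have : opR Z (Z u, u) by [].
rewrite RXY => -[y [_ [/= Xy [z /= Yz ->] uE]]].
by have [_ e1 e2] := XY_Z Xy Yz; rewrite uE -e1 -e2 -uE.
Qed.

(** Y is self-adjoint and contains the essentially self-adjoint operator
    Z u |-> comb (- i / 2) u, hence is its closure. *)
Lemma Y_P x y : Y (x, y) <-> comb (- ii / 2) x = Z y.
Proof.
have [_ _ Yadj] := Ysa.
split=> [Yxy|/closure_comb cl].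
  apply: (can_inj WK); rewrite WZ; apply: (ip_inj hip) => u.
  by rewrite -comb_adj -ZsP; apply: (sa_sym Ysa) Yxy; exact: (XY_range u).2.
rewrite -Yadj => x0 y0 Y0 /=.
have : ip x y0 + ip y (- x0) = 0.
  apply: (closure_orth hip) cl => _ _ [u [-> ->]].
  by rewrite ipNr (sa_sym Ysa (XY_range u).2 Y0) subrr.
by rewrite ipNr => /subr0_eq e; rewrite ipC e -ipC.
Qed.

(** R_t x = comb (line_coef t) (R x) for x in D(R). *)
Definition line_coef (t : option R) : R[i] :=
  if t is Some t then (1 + t%:C * ii) / 2 else ii / 2.

Lemma sa_opRtP t x y : sa_opRt X Y t (x, y) <-> comb (line_coef t) x = Z y.
Proof.
case: t => [t|]; rewrite /sa_opRt.
  suff -> : opRt X Y (Some t) = comb_op (line_coef (Some t)) by exact: closure_comb.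
  have combE u : comb 2^-1 u + (- t%:C) *: comb (- ii / 2) u =
      comb (line_coef (Some t)) u.
    rewrite /comb /line_coef; apply: (ip_injl hip) => h; rewrite !ipE.
    rewrite !(rmorphM, rmorphD, rmorphN, rmorph1) /= realJ iiJ fmorphV rmorph_nat.
    by field.
  apply/seteqP; split=> [[p q] [y' [_ [/= Xp [z /= Yz ->] ->]]]|_ [u ->]] /=.
    have [pE yE zE] := XY_Z Xp Yz; exists (y' + ii *: z).
    by rewrite -combE -yE -zE -pE.
  exists (comb 2^-1 u), ((- t%:C) *: comb (- ii / 2) u); split=> //=.
  - exact: (XY_range u).1.
  - by exists (comb (- ii / 2) u) => //; exact: (XY_range u).2.
have N z : comb (- ii / 2) z = - comb (line_coef None) z.
  by rewrite /comb /line_coef !mulNr rmorphN !scaleNr opprD.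
split=> [[z /= /Y_P]|e].
  by rewrite N scaleN1r => e ->; rewrite linearN -e opprK.
exists (- y); last by rewrite /= scaleN1r opprK.
by apply/Y_P; rewrite N e linearN.
Qed.

Lemma eigP t s : eigenvector (sa_opRt X Y t) s xi <->
  comb (line_coef t) xi = s *: Z xi.
Proof.
split=> [[_ /sa_opRtP ->]|e]; first by rewrite linearZ.
split; last by apply/sa_opRtP; rewrite linearZ.
by apply: contraNN xi_neq0 => /eqP ->; rewrite ip0l.
Qed.

(** As comb a and Z have the commuting adjoints W comb a and W Z, the number
    <comb a xi, Z xi> equals its conjugate. *)
Lemma eig_real a s : comb a xi = s *: Z xi -> s^* = s.
Proof.
move=> e; have n0 : ip (Z xi) (Z xi) != 0.
  apply/eqP => /(ip_eq0 hip)/Zinj xi0; apply: (@xiZ 0); by rewrite linear0 xi0.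
apply: (mulIf n0); rewrite -ipZr -(ipZl _ s) -e [RHS]comb_adj.
by rewrite -Z_comb WZ -ZsP.
Qed.

(** Two eigenvalue equations with different t have a nonzero determinant in xi
    and eta, so they would express xi as a multiple of Z xi. *)
Lemma eig_uniq t t' s s' : comb (line_coef t) xi = s *: Z xi ->
  comb (line_coef t') xi = s' *: Z xi -> t = t' /\ s = s'.
Proof.
move=> e e'.
have det : line_coef t * (line_coef t')^* - (line_coef t)^* * line_coef t' = 0.
  have [] // := @line_rangeZ
    (line_coef t * (line_coef t')^* - (line_coef t)^* * line_coef t')
    (((line_coef t')^* * s - (line_coef t)^* * s') *: xi).
  rewrite linearZ /=; apply: (ip_injl hip) => h.
  have := congr1 (ip^~ h) e; have := congr1 (ip^~ h) e'; rewrite /= !ipE => h1 h2.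
  by apply: (lincomb2 (l := - (line_coef t')^*) (m := (line_coef t)^*) h2 h1); ring.
have tt : t = t'.
  move: det; case: t {e} => [t|]; case: t' {e'} => [t'|] //=;
    rewrite !(rmorphM, rmorphD, rmorph1) /= ?realJ iiJ fmorphV rmorph_nat => det.
  - have : ii * (t%:C - t'%:C) = 0 by apply: (lincomb1 (l := 2) det); field.
    move/eqP; rewrite mulf_eq0 (negPf ii0) /= subr_eq0 => /eqP tt.
    by rewrite (complexI tt).
  - have /eqP : ii = 0 by apply: (lincomb1 (l := - 2) det); field.
    by rewrite (negPf ii0).
  - have /eqP : ii = 0 by apply: (lincomb1 (l := 2) det); field.
    by rewrite (negPf ii0).
split=> //; move: e'; rewrite -tt e => /eqP; rewrite -subr_eq0 -scalerBl scaler_eq0.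
rewrite subr_eq0 => /orP[/eqP //|/eqP /Zinj xi0].
by case: (@xiZ 0); rewrite linear0 xi0.
Qed.

(** * The circle of parameters g *)

(** The eigenvalue equation with parameters t_g and s_(g, a) is a nonzero
    multiple of the normality condition; the factor is 1 / (g - 1), or - i / 2
    when g = 1. *)
Lemma gamma_eq g a t : omap (real_complex R) t = t_gamma g ->
  comb (line_coef t) xi = s_gamma g a *: Z xi <->
  (a - a^* * g) *: Z xi = g *: eta - xi.
Proof.
move=> tg.
have [k [k0 kE kJ ks]] : exists k, [/\ k != 0, line_coef t = - k,
    (line_coef t)^* = k * g & s_gamma g a = k * (a - a^* * g)].
  move: tg; rewrite /t_gamma /s_gamma; case: eqVneq => [->|g1].
    case: t => //= _; exists (- ii / 2); split.
    - by rewrite mulf_neq0 ?oppr_eq0 ?ii0 // invr_eq0 pnatr_eq0.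
    - by field.
    - by rewrite rmorphM /= iiJ fmorphV rmorph_nat mulr1.
    - rewrite mulr1 [a - _]subcJ.
      by apply: (lincomb1 (l := (complex.Im a)%:C) iiM); field.
  case: t => //= t [tE]; exists (g - 1)^-1.
  have g0 : g - 1 != 0 by rewrite subr_eq0.
  split; first by rewrite invr_eq0.
  - rewrite tE.
    by apply: (lincomb1 (l := (g + 1) / (g - 1) / 2) iiM); field.
  - rewrite rmorphM rmorphD rmorphM rmorph1 /= realJ iiJ fmorphV rmorph_nat tE.
    by apply: (lincomb1 (l := - (g + 1) / (g - 1) / 2) iiM); field.
  - by rewrite mulrC.
rewrite ks -scalerA /comb kJ kE.
have -> : - k *: xi + (k * g) *: eta = k *: (g *: eta - xi).
  by apply: (ip_injl hip) => h; rewrite !ipE; ring.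
by split=> [/(scalerI k0) ->|->].
Qed.

End Model.

Section CayleyTransform.
Context {R : realType}.
Local Notation ii := ('i%C : R[i]).
Implicit Types (g s : R[i]) (t : option R).

(** On the unit circle conjugation is inversion, under which i (g + 1) / (g - 1)
    is invariant. *)
Lemma t_gamma_real g : `|g| = 1 -> exists t, omap (real_complex R) t = t_gamma g.
Proof.
move=> gn; rewrite /t_gamma; case: eqVneq => [_|g1]; first by exists None.
have gg : g * g^* = 1 by rewrite -normCK gn expr1n.
have g0 : g - 1 != 0 by rewrite subr_eq0.
have gn0 : g != 0 by rewrite -normr_eq0 gn oner_eq0.
have gV : g^* = g^-1 by apply: (mulfI gn0); rewrite gg divff.
set z := _ * _; have /CrealP : z^* = z.
  rewrite /z !rmorphM fmorphV !rmorphD rmorphN rmorph1 /= iiJ gV.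
  have g0' : 1 - g != 0 by rewrite subr_eq0 eq_sym.
  by field; rewrite g0 gn0 mulN1r.
by move=> /complex_realP[t ->]; exists (Some t).
Qed.

(** The Cayley transform g = (t + i) / (t - i) inverts t_g.  For this g the
    parameters a with s_(g, a) = s form a real line, on which a = t - s + i is
    never 0; for g = 1 the same holds of a = 1 + s i. *)
Lemma gamma_surj t s : s^* = s -> exists g a,
  [/\ `|g| = 1, a != 0, omap (real_complex R) t = t_gamma g & s = s_gamma g a].
Proof.
move=> sJ; have /complex_realP[r sE] : s \is Num.real by apply/CrealP.
case: t => [t|]; last first.
  exists 1, (1 + r%:C * ii); split.
  - by rewrite normr1.
  - by rewrite eq_complex /= !(mul0r, mulr0, mulr1, subr0, addr0, oner_eq0).
  - by rewrite /t_gamma eqxx.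
  - by rewrite /s_gamma eqxx sE /= !(mul0r, mulr0, mulr1, add0r, addr0).
have tp : t%:C + ii != 0.
  by rewrite eq_complex /= add0r oner_eq0 andbF.
have tm : t%:C - ii != 0.
  by rewrite eq_complex /= sub0r oppr_eq0 oner_eq0 andbF.
have iN : ii != 0 := ii0.
have g1 : (t%:C + ii) / (t%:C - ii) - 1 = 2 * ii / (t%:C - ii) by field.
have gN : (t%:C + ii) / (t%:C - ii) == 1 = false.
  apply/negbTE; rewrite -subr_eq0 g1 !mulf_neq0 ?invr_eq0 ?pnatr_eq0 //.
have aJ : (t%:C - r%:C + ii)^* = t%:C - r%:C - ii.
  by rewrite !rmorphD rmorphN /= !realJ iiJ.
exists ((t%:C + ii) / (t%:C - ii)), (t%:C - r%:C + ii); split.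
- rewrite normrM normfV -[X in X / _]norm_conjC rmorphD /= realJ iiJ divff //.
  by rewrite normr_eq0.
- by rewrite eq_complex /= subr0 add0r oner_eq0 andbF.
- by rewrite /t_gamma gN g1 /=; congr Some; field; rewrite tm iN.
- rewrite /s_gamma gN g1 sE aJ.
  by field; rewrite tm iN.
Qed.

End CayleyTransform.

(** * The theorem *)

Local Open Scope complex_scope.

Theorem theorem17 (R : realType) (H : completeNormedModType R[i])
    (ip : {dot H for Num.conj}) (hip : forall x : H, ip x x = `|x| ^+ 2)
    (Z : {linear H -> H})
    (Zbounded : bounded_op (graph Z))
    (Znormal : normal_op ip (graph Z))
    (Zker : ker_op (graph Z) = [set 0])
    (Runbounded : ~ bounded_op (opR Z))
    (xi : H) (hxi : ~ dom (opR Z) xi)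
    (W : {linear H -> H}) (Wunitary : unitary ip W)
    (WR : forall x y z, adj ip (opR Z) (x, y) -> opR Z (x, z) -> W y = z)
    (P : {linear H -> H}) (Pproj : orth_projection ip P)
    (Prange : range P = line xi)
    (X Y : set (H * H)) (Xsa : self_adjoint ip X) (Ysa : self_adjoint ip Y)
    (XYcomm : strongly_commuting ip X Y)
    (RXY : opR Z = add_op X (scale_op 'i%C Y)) :
  let TC (a : R[i]) := opT ip Z P (line (xi, a *: adjf ip W xi)) in
  let eig (t : option R) (s : R[i]) := eigenvector (sa_opRt X Y t) s xi in
  [/\ forall a : R[i], a != 0 ->
        (normal_op ip (TC a) <->
         exists (t : option R) (s : R[i]), eig t s /\
           exists g : R[i], [/\ `|g| = 1,
             omap (real_complex R) t = t_gamma g & s = s_gamma g a]),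
      (exists2 a : R[i], a != 0 & normal_op ip (TC a)) <->
        (exists (t : option R) (s : R[i]), eig t s)
    & forall a : R[i], a != 0 -> normal_op ip (TC a) ->
        (exists! ts : option R * R[i], eig ts.1 ts.2) /\
        forall g : R[i],
          (a - a^* * g) *: Z xi = g *: adjf ip W xi - xi -> `|g| = 1 ->
          forall (t : option R) (s : R[i]), eig t s ->
            omap (real_complex R) t = t_gamma g /\ s = s_gamma g a].
Proof.
have adjfP (f : H -> H) y : (exists z, adj ip (graph f) (y, z)) ->
    forall x, ip (f x) y = ip x (adjf ip f y).
  by move=> /getPex h x; exact: (h x (f x) erefl).
have [[_ _ Zdom Znorm] _] := Znormal.
have ZsP x y : ip (Z x) y = ip x (adjf ip Z y).
  by apply: adjfP; apply: Zdom; exists (Z y).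
have [Wiso Wsurj] := Wunitary.
have WiP x y : ip (W x) y = ip x (adjf ip W y).
  apply: adjfP; have [z _ <-] : range W y by rewrite Wsurj.
  by exists z => u v; rewrite /graph /= => ->; rewrite Wiso.
have WK : cancel W (adjf ip W).
  by move=> x; apply: (ip_inj hip) => u; rewrite -WiP Wiso.
have WiK : cancel (adjf ip W) W.
  move=> y; have [z _ <-] : range W y by rewrite Wsurj.
  by rewrite WK.
have ZsD x y : adjf ip Z (x + y) = adjf ip Z x + adjf ip Z y.
  by apply: (ip_inj hip) => u; rewrite ipDr -!ZsP ipDr.
have ZsZ c x : adjf ip Z (c *: x) = c *: adjf ip Z x.
  by apply: (ip_inj hip) => u; rewrite ipZr -!ZsP ipZr.
have Zs_adj x y : ip (adjf ip Z x) y = ip x (Z y).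
  by rewrite ipC -ZsP -ipC.
have Znorm' x : ip (Z x) (Z x) = ip (adjf ip Z x) (adjf ip Z x).
  apply/(norm_eqP hip)/(Znorm x) => // u v; rewrite /graph /= => ->; exact: ZsP.
have Zpol x y : ip (Z x) (Z y) = ip (adjf ip Z x) (adjf ip Z y).
  by apply: polarization; rewrite // -?ZsZ -?ZsD -?linearZ -?linearD.
have Zcomm x : Z (adjf ip Z x) = adjf ip Z (Z x).
  by apply: (ip_inj hip) => u; rewrite -Zs_adj -Zpol ZsP.
(* Z^* Z x = Z Z^* x lies in both domains, so W sends Z x, its image under R^*,
   to Z^* x, its image under R. *)
have WZ x : W (Z x) = adjf ip Z x.
  by apply: (WR (adjf ip Z (Z x))); [exact/(adj_opRP hip ZsP) | exact/esym/Zcomm].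
have ZW x : Z (W x) = adjf ip Z x.
  apply: (ip_injl hip) => u.
  by rewrite ZsP -WZ Wiso Zs_adj.
have Zinj x : Z x = 0 -> x = 0.
  by move=> Zx; have : ker_op (graph Z) x; [exact/esym | rewrite Zker].
have xiZ x : Z x <> xi by move=> e; apply: hxi; exists x; exact/esym.
have [PP Psym] := Pproj.
have Pxi x : exists c, P x = c *: xi.
  have : range P (P x) by exists x.
  by rewrite Prange => -[c _ <-]; exists c.
have Pxi_fix : P xi = xi.
  have : line xi xi by exists 1 => //; rewrite scale1r.
  by rewrite -Prange => -[x _ <-]; rewrite PP.
move=> TC eig.
have normalP a : a != 0 -> normal_op ip (TC a) <->
    exists2 g, `|g| = 1 & (a - a^* * g) *: Z xi = g *: adjf ip W xi - xi.
  exact: opT_normalP.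
have eigE t s : eig t s <-> comb (adjf ip W) (line_coef t) xi = s *: Z xi.
  exact: eigP.
have gammaE g a t : omap (real_complex R) t = t_gamma g ->
    eig t (s_gamma g a) <-> (a - a^* * g) *: Z xi = g *: adjf ip W xi - xi.
  by move=> tg; rewrite eigE; exact: gamma_eq.
have uniq t t' s s' : eig t s -> eig t' s' -> t = t' /\ s = s'.
  move=> /eigE e /eigE e'; exact: (eig_uniq hip Zinj xiZ e e').
have part1 a : a != 0 -> normal_op ip (TC a) <->
    exists (t : option R) (s : R[i]), eig t s /\ exists g : R[i], [/\ `|g| = 1,
      omap (real_complex R) t = t_gamma g & s = s_gamma g a].
  move=> a0; rewrite normalP //; split=> [[g g1 e]|[t [s [e [g [g1 tg sE]]]]]].
    have [t tg] := t_gamma_real g1; exists t, (s_gamma g a).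
    by split; [exact/(gammaE _ _ _ tg) | exists g].
  by exists g => //; apply/(gammaE _ _ _ tg); rewrite -sE.
split=> //.
- split=> [[a a0 /(part1 a a0)[t [s [e _]]]]|[t [s e]]]; first by exists t, s.
  have /(gamma_surj t)[g [a [g1 a0 tg sE]]] : s^* = s.
    by move/eigE: (e); exact: eig_real.
  by exists a => //; apply/part1 => //; exists t, s; split=> //; exists g.
- move=> a a0 Na; split.
    have [t [s [e _]]] := (part1 a a0).1 Na; exists (t, s); split=> // -[t' s'] e'.
    by have [-> ->] := uniq _ _ _ _ e e'.
  move=> g ge g1 t s e; have [t' tg] := t_gamma_real g1.
  have [-> ->] := uniq _ _ _ _ e ((gammaE _ _ _ tg).2 ge).
  by [].
Qed.
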